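(* For all positive integers $n$ and $j$, \[ \sum_{k=0}^n\binom{n}{k}\frac{2^k}{k+1}\left((-1)^k\frac{F_{j(k+1)}}{L_j^k}\Big(\frac{L_j}{\sqrt5F_j}\Big)^n-(1+(-1)^n)\frac{2^{k+3}-2}{k+2}F_jB_{k+2}\right)=0, \] and in particular \[ \sum_{k=1}^{2n}(-1)^k\binom{2n-1}{k-1}\frac{2^kF_{jk}}{kL_j^k}=0. \] Similarly, \[ \sum_{k=0}^n\binom{n}{k}2^k\left((-1)^k\frac{L_{jk}}{L_j^k}\Big(\frac{L_j}{\sqrt5F_j}\Big)^n-\frac{1+(-1)^n}{n-k+1}B_k\right)=1+(-1)^n, \] and \[ \sum_{k=0}^{2n-1}(-1)^k\binom{2n-1}{k}\frac{2^kL_{jk}}{L_j^k}=0. \]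
   Context: $F_n$ and $L_n$ denote the Fibonacci and Lucas numbers: $F_0=0,F_1=1$, $L_0=2,L_1=1$, and $u_n=u_{n-1}+u_{n-2}$. The Bernoulli numbers $B_n$ are defined by $\sum_{n\ge0}B_n\frac{z^n}{n!}=\frac{z}{e^z-1}$ (so $B_0=1$, $B_1=-\tfrac12$, $B_2=\tfrac16$, $B_{2n+1}=0$ for $n\ge1$). *)

(* Defs.v *)
From Stdlib Require Import Reals Factorial Wf_nat Lra Lia.
From Coquelicot Require Import Coquelicot.
Open Scope R_scope.

Fixpoint fib (n : nat) : nat :=
  match n with
  | O => 0
  | S m => match m with O => 1 | S p => fib m + fib p end
  end.

Fixpoint lucas (n : nat) : nat :=
  match n with
  | O => 2
  | S m => match m with O => 1 | S p => lucas m + lucas p end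
  end.

(* B is the Bernoulli sequence: sum_n B_n z^n / n! = z / (e^z - 1) for all z
   near 0. The neighbourhood [locally'] is punctured because the right-hand
   side is 0 / 0 at z = 0. [bernoulli_exists] shows that such a B exists; it
   is unique, because a power series is determined by its sum near 0. *)
Definition is_bernoulli (B : nat -> R) : Prop :=
  locally' 0 (fun z : R =>
    is_pseries (fun n => B n / INR (fact n)) z (z / (exp z - 1))).

(* Coefficients of the reciprocal series of (e^z - 1) / z; [tab n k] is the
   k-th one as soon as k <= n. *)
Fixpoint tab (n : nat) : nat -> R :=
  match n with
  | O => fun _ => 1
  | S m => fun k =>
      if Nat.leb k m then tab m k
      else - sum_f_R0 (fun i => tab m i * / INR (fact (m + 2 - i))) m
  end.

Lemma tab_stable n k : (k <= n)%nat -> tab n k = tab k k.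
Proof.
  induction n as [|n IH]; intros H.
  - replace k with 0%nat by lia. reflexivity.
  - destruct (Nat.eq_dec k (S n)) as [->|H']; [reflexivity|].
    simpl. replace (Nat.leb k n) with true
      by (symmetry; apply Nat.leb_le; lia).
    apply IH; lia.
Qed.

Lemma tab_rec n :
  tab (S n) (S n) =
  - sum_f_R0 (fun i => tab i i * / INR (fact (n + 2 - i))) n.
Proof.
  unfold tab at 1; fold tab. replace (Nat.leb (S n) n) with false
    by (symmetry; apply Nat.leb_gt; lia).
  f_equal. apply sum_eq; intros i Hi. rewrite (tab_stable n i Hi). reflexivity.
Qed.

Lemma sum_inv_fact_le n :
  sum_f_R0 (fun i => / INR (fact (n + 2 - i))) n <= 1 - / INR (fact (n + 2)).
Proof.
  induction n as [|n IH].
  - simpl. lra.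
  - rewrite decomp_sum by lia. simpl pred.
    rewrite (sum_eq _ (fun i => / INR (fact (n + 2 - i)))).
    2: { intros i Hi. reflexivity. }
    replace (S n + 2 - 0)%nat with (S (n + 2)) by lia.
    replace (S n + 2)%nat with (S (n + 2)) by lia.
    assert (H2 : / INR (fact (S (n + 2))) <= / 2 * / INR (fact (n + 2))).
    { rewrite fact_simpl, mult_INR, Rinv_mult.
      apply Rmult_le_compat_r.
      - left. apply Rinv_0_lt_compat, INR_fact_lt_0.
      - apply Rinv_le_contravar; [lra|].
        rewrite S_INR, plus_INR. simpl (INR 2).
        pose proof (pos_INR n). lra. }
    lra.
Qed.

Lemma tab_bound n : Rabs (tab n n) <= 1.
Proof.
  induction n as [n IH] using (well_founded_induction lt_wf).
  destruct n as [|n].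
  - simpl. rewrite Rabs_R1. lra.
  - rewrite tab_rec, Rabs_Ropp.
    eapply Rle_trans; [apply Rsum_abs|].
    eapply Rle_trans; [apply sum_Rle with
      (Bn := fun i => / INR (fact (n + 2 - i)))|].
    + intros i Hi. rewrite Rabs_mult.
      assert (Hf : 0 < / INR (fact (n + 2 - i)))
        by apply Rinv_0_lt_compat, INR_fact_lt_0.
      rewrite (Rabs_right (/ _)) by lra.
      rewrite <- (Rmult_1_l (/ _)) at 2.
      apply Rmult_le_compat_r; [lra|]. apply IH. lia.
    + pose proof (sum_inv_fact_le n).
      assert (0 < / INR (fact (n + 2)))
        by apply Rinv_0_lt_compat, INR_fact_lt_0.
      lra.
Qed.

Lemma CV_radius_of_bound (a : nat -> R) (x : R) :
  (forall n, Rabs (a n) <= 1) -> Rabs x < 1 -> Rbar_lt (Rabs x) (CV_radius a).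
Proof.
  intros Ha Hx. apply Rbar_lt_le_trans with (Finite 1); [exact Hx|].
  apply (proj1 (CV_radius_bounded a)).
  exists 1. intros n. rewrite pow1, Rmult_1_r. apply Ha.
Qed.

Lemma bernoulli_exists : exists B : nat -> R, is_bernoulli B.
Proof.
  set (b := fun n => tab n n).
  set (a := fun n => / INR (fact (S n))).
  exists (fun n => b n * INR (fact n)).
  exists (mkposreal 1 Rlt_0_1). intros z Hz Hz0.
  assert (Hz1 : Rabs z < 1).
  { change (Rabs (z + - 0) < 1) in Hz. rewrite Ropp_0, Rplus_0_r in Hz.
    exact Hz. }
  apply is_pseries_ext with b.
  { intros n. change (b n = b n * INR (fact n) / INR (fact n) :> R).
    field. apply INR_fact_neq_0. }
  assert (Ra : Rbar_lt (Rabs z) (CV_radius a)).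
  { apply CV_radius_of_bound; [|exact Hz1]. intros n. unfold a.
    assert (1 <= INR (fact (S n))).
    { change 1 with (INR 1). apply le_INR. pose proof (lt_O_fact (S n)). lia. }
    rewrite Rabs_right.
    - rewrite <- Rinv_1. apply Rinv_le_contravar; lra.
    - left. apply Rinv_0_lt_compat. lra. }
  assert (Rb : Rbar_lt (Rabs z) (CV_radius b))
    by (apply CV_radius_of_bound; [exact tab_bound | exact Hz1]).
  assert (Hb : is_pseries b z (PSeries b z))
    by (apply PSeries_correct, CV_radius_inside, Rb).
  assert (Ha : is_pseries a z (/ z * (exp z - 1))).
  { pose proof (is_pseries_decr_1 (fun n => / INR (fact n)) z (/ z) (exp z)
                  (Rinv_l z Hz0) (is_exp_Reals z)) as H.
    replace (/ z * (exp z - 1)) with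
      (scal (/ z) (plus (exp z) (opp (/ INR (fact 0)))) : R); [exact H|].
    unfold scal, plus, opp; simpl. unfold mult; simpl.
    rewrite Rinv_1. ring. }
  pose proof (is_pseries_mult b a z _ _ Hb Ha Rb Ra) as Hm.
  apply is_pseries_unique in Hm.
  assert (H1 : PSeries (PS_mult b a) z = 1).
  { rewrite PSeries_decr_1.
    2: { apply ex_pseries_mult; assumption. }
    rewrite (PSeries_ext _ (fun _ => 0)).
    - rewrite PSeries_const_0. unfold PS_mult, b, a. simpl. field.
    - intros n. unfold PS_decr_1, PS_mult. rewrite tech5. unfold b at 2.
      rewrite tab_rec. replace (S n - S n)%nat with 0%nat by lia.
      unfold a at 2. simpl (fact 1). simpl (INR 1). rewrite Rinv_1, Rmult_1_r.
      rewrite (sum_eq _ (fun i => b i * / INR (fact (n + 2 - i)))).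
      + unfold b. ring.
      + intros i Hi. unfold a. do 4 f_equal. lia. }
  rewrite H1 in Hm.
  assert (He : exp z - 1 <> 0).
  { intros E. apply Hz0, exp_inv. rewrite exp_0. lra. }
  replace (z / (exp z - 1)) with (PSeries b z); [exact Hb|].
  apply (Rmult_eq_reg_r (/ z * (exp z - 1))).
  - rewrite <- Hm. field. split; assumption.
  - apply Rmult_integral_contrapositive_currified; [|exact He].
    apply Rinv_neq_0_compat, Hz0.
Qed.

(* Main.v *)
(* Put a = phi^j and b = psi^j, so that F_j = (a - b) / sqrt 5 and L_j = a + b.
   Then 1 - 2a/L_j and 1 - 2b/L_j are -q and q with q = sqrt 5 F_j / L_j, and
   the binomial theorem evaluates the Fibonacci and Lucas sums (after
   C(n,k)/(k+1) = C(n+1,k+1)/(n+1) for the Fibonacci ones). What remains are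
   sum_k C(N,k) 2^k B_k = 0 for N odd and sum_k C(N,k) (4^k - 2^k) B_k = 0 for
   N even; these sums are, up to N!, the coefficients of 2z/(e^z - e^(-z)) and
   -2z/(e^z + e^(-z)), which are even and odd functions respectively. *)
Require Import Defs.
From Stdlib Require Import Reals Factorial Arith Lra Lia.
From Coquelicot Require Import Coquelicot.
Open Scope R_scope.

(** * Power series: parity and binomial transforms *)

(** If the radius were below r/2, the terms at the point r/2 could not tend to 0, although the
    series converges there. *)
Lemma CV_radius_pos (a : nat -> R) (r : R) :
  0 < r -> (forall z, z <> 0 -> Rabs z < r -> ex_pseries a z) ->
  Rbar_lt 0 (CV_radius a).
Proof.
  intros Hr H. apply Rbar_lt_le_trans with (Finite (r / 2)).
  { simpl; lra. }
  apply Rbar_not_lt_le. intros Hlt.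
  assert (Hr2 : Rabs (r / 2) = r / 2) by (apply Rabs_pos_eq; lra).
  apply (CV_disk_outside a (r / 2)).
  - rewrite Hr2. exact Hlt.
  - apply ex_series_lim_0, ex_pseries_R, H; [lra|]. rewrite Hr2. lra.
Qed.

(** The series of g(-z) has coefficients (-1)^n a_n and that of s g(z) has s a_n, so uniqueness of
    coefficients equates them. The point 0 is left out because the functions of interest are 0/0
    there; the condition on [a 0] takes its place. *)
Lemma pseries_parity (a : nat -> R) (g : R -> R) (s r : R) :
  0 < r ->
  (forall z, z <> 0 -> Rabs z < r -> is_pseries a z (g z)) ->
  (forall z, z <> 0 -> g (- z) = s * g z) ->
  s * a 0%nat = a 0%nat ->
  forall n, (-1) ^ n * a n = s * a n.
Proof.
  intros Hr Ha Hg H0.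
  assert (H1 : forall z, z <> 0 -> Rabs z < r ->
    is_pseries (fun n => (-1) ^ n * a n) z (s * g z)).
  { intros z Hz Hzr. rewrite <- Hg by exact Hz. apply is_pseries_R.
    apply is_series_ext with (fun n => a n * (- z) ^ n).
    - intros n. change (a n * (- z) ^ n = (-1) ^ n * a n * z ^ n :> R).
      replace (- z) with (-1 * z) by ring. rewrite Rpow_mult_distr. ring.
    - apply is_pseries_R, Ha; [lra|]. rewrite Rabs_Ropp. exact Hzr. }
  assert (H2 : forall z, z <> 0 -> Rabs z < r ->
    is_pseries (fun n => s * a n) z (s * g z)).
  { intros z Hz Hzr. apply (is_pseries_scal s a z (g z)).
    - apply Rmult_comm.
    - apply Ha; assumption. }
  intros n.
  apply (PSeries_ext_recip (fun n => (-1) ^ n * a n) (fun n => s * a n)).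
  - apply (CV_radius_pos _ r Hr). intros z Hz Hzr. eexists.
    apply H1; assumption.
  - apply (CV_radius_pos _ r Hr). intros z Hz Hzr. eexists.
    apply H2; assumption.
  - exists (mkposreal r Hr). intros z Hz.
    assert (Hzr : Rabs z < r).
    { change (Rabs (z + - 0) < r) in Hz.
      rewrite Ropp_0, Rplus_0_r in Hz. exact Hz. }
    destruct (Req_dec z 0) as [->|Hz0].
    + rewrite !PSeries_0, H0. simpl. ring.
    + rewrite (is_pseries_unique _ _ _ (H1 z Hz0 Hzr)).
      rewrite (is_pseries_unique _ _ _ (H2 z Hz0 Hzr)). reflexivity.
Qed.

Lemma CV_radius_exp : CV_radius (fun n => / INR (fact n)) = p_infty.
Proof.
  apply CV_radius_infinite_DAlembert.
  - intros n. apply Rinv_neq_0_compat, INR_fact_neq_0.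
  - apply is_lim_seq_ext with (fun n => / INR (S n)).
    + intros n. rewrite fact_simpl, mult_INR, Rabs_pos_eq.
      * field. split; [apply INR_fact_neq_0|apply not_0_INR; lia].
      * left. unfold Rdiv. rewrite Rinv_inv.
        apply Rmult_lt_0_compat; [|apply INR_fact_lt_0].
        apply Rinv_0_lt_compat. rewrite <- mult_INR, <- fact_simpl.
        apply INR_fact_lt_0.
    + apply (is_lim_seq_incr_1 (fun n => / INR n)).
      replace (Finite 0) with (Rbar_inv p_infty) by reflexivity.
      apply is_lim_seq_inv; [apply is_lim_seq_INR|discriminate].
Qed.

(** Multiplying an exponential generating function by e^z gives that of the binomial transform. If
    the product is even (s = 1) or odd (s = -1), its coefficients of the other parity vanish. *)
Lemma binomial_transform_parity (c : nat -> R) (f : R -> R) (s r : R) :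
  0 < r ->
  (forall z, z <> 0 -> Rabs z < r ->
    is_pseries (fun n => c n / INR (fact n)) z (f z)) ->
  (forall z, z <> 0 -> exp (- z) * f (- z) = s * (exp z * f z)) ->
  s * c 0%nat = c 0%nat ->
  forall N, (-1) ^ N <> s ->
  sum_f_R0 (fun k => Binomial.C N k * c k) N = 0.
Proof.
  intros Hr Hf Hs H0 N HN.
  set (p := fun n => c n / INR (fact n)) in Hf.
  set (E := fun n => / INR (fact n)).
  assert (Hp : Rbar_lt 0 (CV_radius p)).
  { apply (CV_radius_pos _ r Hr). intros z Hz Hzr. eexists.
    apply Hf; assumption. }
  (* The Cauchy product needs |z| below the radius of convergence of [p], of which only positivity
     is known; hence r shrinks to r'. *)
  assert (Hr' : exists r', 0 < r' <= r /\ Rbar_le r' (CV_radius p)).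
  { destruct (CV_radius p) as [t| |]; simpl in Hp.
    - exists (Rmin r t). split.
      + split; [apply Rmin_glb_lt; assumption|apply Rmin_l].
      + apply Rmin_r.
    - exists r. simpl. split; [lra|exact I].
    - contradiction. }
  destruct Hr' as [r' [[Hr'0 Hr'r] Hr'p]].
  assert (Hpar : (-1) ^ N * PS_mult p E N = s * PS_mult p E N).
  { apply (pseries_parity _ (fun z => f z * exp z) s r' Hr'0).
    - intros z Hz Hzr. apply is_pseries_mult.
      + apply Hf; [exact Hz|lra].
      + apply is_exp_Reals.
      + apply Rbar_lt_le_trans with (Finite r'); [exact Hzr|exact Hr'p].
      + unfold E. rewrite CV_radius_exp. exact I.
    - intros z Hz. rewrite Rmult_comm, Hs by exact Hz. ring.
    - unfold PS_mult, p, E. simpl. unfold Rdiv. rewrite Rinv_1. rewrite !Rmult_1_r.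
      exact H0. }
  assert (Hsum : sum_f_R0 (fun k => Binomial.C N k * c k) N
                 = INR (fact N) * PS_mult p E N).
  { unfold PS_mult. rewrite scal_sum. apply sum_eq. intros k Hk.
    unfold Binomial.C, p, E. field.
    split; apply INR_fact_neq_0. }
  rewrite Hsum.
  assert (PS_mult p E N = 0).
  { apply (Rmult_eq_reg_l ((-1) ^ N - s)); [|lra].
    rewrite Rmult_minus_distr_r, Hpar. ring. }
  rewrite H. ring.
Qed.

(** * Bernoulli numbers *)

(** The substitution of tz for z. Both t = 2 and t = 4 enter the binomial sums; t = 1 merely turns
    the punctured neighbourhood into an explicit radius. *)
Lemma bernoulli_scaled (B : nat -> R) (t : R) :
  0 < t -> is_bernoulli B ->
  exists r, 0 < r /\ forall z, z <> 0 -> Rabs z < r ->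
    is_pseries (fun n => t ^ n * B n / INR (fact n)) z
      (t * z / (exp (t * z) - 1)).
Proof.
  intros Ht [eps H]. pose proof (cond_pos eps) as He.
  exists (eps / t). split; [apply Rdiv_lt_0_compat; assumption|].
  intros z Hz Hzr. apply is_pseries_R.
  apply is_series_ext with (fun n => B n / INR (fact n) * (t * z) ^ n).
  { intros n. change (B n / INR (fact n) * (t * z) ^ n =
      t ^ n * B n / INR (fact n) * z ^ n :> R).
    rewrite Rpow_mult_distr. field. apply INR_fact_neq_0. }
  apply is_pseries_R, H.
  - change (Rabs (t * z + - 0) < eps). rewrite Ropp_0, Rplus_0_r.
    rewrite Rabs_mult, (Rabs_pos_eq t) by lra.
    apply Rmult_lt_reg_r with (/ t); [apply Rinv_0_lt_compat, Ht|].
    replace (t * Rabs z * / t) with (Rabs z) by (field; lra). exact Hzr.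
  - apply Rmult_integral_contrapositive_currified; lra.
Qed.

Lemma exp_neq_1 (z : R) : z <> 0 -> exp z <> 1.
Proof. intros Hz E. apply Hz, exp_inv. rewrite E, exp_0. reflexivity. Qed.

Lemma exp_double (z : R) : exp (2 * z) = exp z * exp z.
Proof. rewrite <- exp_plus. f_equal. ring. Qed.

Lemma bernoulli_sum_2 (B : nat -> R) (N : nat) :
  is_bernoulli B -> Nat.Odd N ->
  sum_f_R0 (fun k => Binomial.C N k * (2 ^ k * B k)) N = 0.
Proof.
  intros hB HN. destruct (bernoulli_scaled B 2 ltac:(lra) hB) as [r [Hr H]].
  apply (binomial_transform_parity _ _ 1 r Hr H).
  - intros z Hz.
    replace (2 * - z) with (- (2 * z)) by ring. rewrite !exp_Ropp.
    pose proof (exp_neq_1 (2 * z) ltac:(lra)) as H2.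
    rewrite exp_double in *. pose proof (exp_pos z).
    field. repeat split; lra.
  - ring.
  - destruct HN as [m ->]. rewrite Nat.add_1_r, pow_1_odd. lra.
Qed.

Lemma bernoulli_sum_4 (B : nat -> R) (N : nat) :
  is_bernoulli B -> Nat.Even N ->
  sum_f_R0 (fun k => Binomial.C N k * ((4 ^ k - 2 ^ k) * B k)) N = 0.
Proof.
  intros hB HN.
  destruct (bernoulli_scaled B 2 ltac:(lra) hB) as [r2 [Hr2 H2]].
  destruct (bernoulli_scaled B 4 ltac:(lra) hB) as [r4 [Hr4 H4]].
  apply (binomial_transform_parity _
    (fun z => 4 * z / (exp (4 * z) - 1) - 2 * z / (exp (2 * z) - 1))
    (-1) (Rmin r2 r4)).
  - apply Rmin_glb_lt; assumption.
  - intros z Hz Hzr.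
    pose proof (Rmin_l r2 r4). pose proof (Rmin_r r2 r4).
    pose proof (is_pseries_minus _ _ z _ _
      (H4 z Hz ltac:(lra)) (H2 z Hz ltac:(lra))) as HH.
    eapply is_pseries_ext; [|exact HH].
    intros n. unfold PS_minus, PS_plus, PS_opp, plus, opp; simpl.
    field. apply INR_fact_neq_0.
  (* With u = e^(2z), the difference 4z/(u^2 - 1) - 2z/(u - 1) is -2z/(u + 1); multiplied by e^z it
     becomes -2z/(e^z + e^(-z)), which is odd. *)
  - intros z Hz.
    replace (4 * - z) with (- (2 * (2 * z))) by ring.
    replace (2 * - z) with (- (2 * z)) by ring.
    replace (4 * z) with (2 * (2 * z)) by ring. rewrite !exp_Ropp.
    pose proof (exp_neq_1 (2 * z) ltac:(lra)) as E2.
    pose proof (exp_neq_1 (2 * (2 * z)) ltac:(lra)) as E4.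
    rewrite !exp_double in *. pose proof (exp_pos z).
    field. repeat split; lra.
  (* The constant coefficient is (4^0 - 2^0) B_0 = 0, as oddness demands. *)
  - simpl. ring.
  - destruct HN as [m ->]. rewrite pow_1_even. lra.
Qed.

Lemma absorption (n k : nat) :
  (k <= n)%nat ->
  Binomial.C n k / (INR k + 1) = Binomial.C (S n) (S k) / (INR n + 1).
Proof.
  intros Hk. unfold Binomial.C. replace (S n - S k)%nat with (n - k)%nat by lia.
  rewrite !fact_simpl, !mult_INR, !S_INR.
  pose proof (pos_INR n). pose proof (pos_INR k).
  field. repeat split; try apply INR_fact_neq_0; lra.
Qed.

Lemma C_n_1 (n : nat) : Binomial.C (S n) 1 = INR n + 1.
Proof.
  unfold Binomial.C. replace (S n - 1)%nat with n by lia.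
  rewrite fact_simpl, mult_INR, S_INR. simpl. field. apply INR_fact_neq_0.
Qed.

Lemma binomial_1 (x : R) (n : nat) :
  sum_f_R0 (fun k => Binomial.C n k * x ^ k) n = (x + 1) ^ n.
Proof.
  rewrite binomial. apply sum_eq. intros k _. rewrite pow1. ring.
Qed.

(** The partial sums are constant from index m on. The case m = 1 supplies the summand z/2 in
    [bernoulli_odd]. *)
Lemma is_pseries_monomial (x c : R) (m : nat) :
  is_pseries (fun n => if n =? m then c else 0) x (c * x ^ m).
Proof.
  apply is_pseries_R.
  apply (filterlim_ext_loc (fun _ => c * x ^ m)); [|apply filterlim_const].
  exists m. intros n Hn. rewrite sum_n_Reals.
  induction Hn as [|n Hn IH].
  - destruct m as [|m]; [simpl; ring|].
    rewrite tech5, Nat.eqb_refl, (sum_eq _ (fun _ => 0)).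
    + rewrite sum_cte. ring.
    + intros i Hi. replace (i =? S m) with false; [ring|].
      symmetry. apply Nat.eqb_neq. lia.
  - rewrite tech5, <- IH. replace (S n =? m) with false; [ring|].
    symmetry. apply Nat.eqb_neq. lia.
Qed.

(* [z / (e^z - 1) + z / 2] is even. *)
Lemma bernoulli_odd (B : nat -> R) (n : nat) :
  is_bernoulli B -> Nat.Odd n -> B n = if n =? 1 then - / 2 else 0.
Proof.
  intros hB Hn.
  destruct (bernoulli_scaled B 1 ltac:(lra) hB) as [r [Hr H]].
  set (d := fun n => if n =? 1 then / 2 else 0).
  assert (Hpar : (-1) ^ n * (B n / INR (fact n) + d n)
                 = 1 * (B n / INR (fact n) + d n)).
  { apply (pseries_parity (fun n => B n / INR (fact n) + d n)
      (fun z => z / (exp z - 1) + / 2 * z ^ 1) 1 r Hr).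
    - intros z Hz Hzr.
      pose proof (is_pseries_plus _ _ z _ _ (H z Hz Hzr)
        (is_pseries_monomial z (/ 2) 1)) as HH.
      rewrite Rmult_1_l in HH.
      eapply is_pseries_ext; [|exact HH].
      intros k. unfold PS_plus, plus, d; simpl. rewrite pow1.
      unfold Rdiv. ring.
    - intros z Hz. rewrite exp_Ropp.
      pose proof (exp_neq_1 z Hz). pose proof (exp_pos z).
      field. repeat split; lra.
    - ring. }
  assert (Hd : B n / INR (fact n) = - d n).
  { destruct Hn as [m ->]. rewrite Nat.add_1_r, pow_1_odd in Hpar.
    rewrite Nat.add_1_r. lra. }
  replace (B n) with (B n / INR (fact n) * INR (fact n))
    by (field; apply INR_fact_neq_0).
  rewrite Hd. unfold d. destruct (Nat.eqb_spec n 1) as [->|_]; simpl; ring.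
Qed.

(** * Binet formulas *)

Definition golden : R := (1 + sqrt 5) / 2.
Definition golden_conj : R := (1 - sqrt 5) / 2.

Lemma sqrt5_sqr : sqrt 5 * sqrt 5 = 5.
Proof. apply sqrt_sqrt. lra. Qed.

Lemma sqrt5_pos : 0 < sqrt 5.
Proof. apply sqrt_lt_R0. lra. Qed.

Lemma golden_sqr : golden * golden = golden + 1.
Proof. pose proof sqrt5_sqr. unfold golden. nra. Qed.

Lemma golden_conj_sqr : golden_conj * golden_conj = golden_conj + 1.
Proof. pose proof sqrt5_sqr. unfold golden_conj. nra. Qed.

(** Powers of either root of x^2 = x + 1 obey the Fibonacci recurrence, so induction on two
    consecutive indices suffices. *)
Lemma binet_fib (n : nat) :
  sqrt 5 * INR (fib n) = golden ^ n - golden_conj ^ n.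
Proof.
  enough (sqrt 5 * INR (fib n) = golden ^ n - golden_conj ^ n /\
    sqrt 5 * INR (fib (S n)) = golden ^ S n - golden_conj ^ S n) by tauto.
  induction n as [|n [IH1 IH2]].
  - unfold golden, golden_conj. simpl. lra.
  - split; [exact IH2|].
    change (fib (S (S n))) with (fib (S n) + fib n)%nat.
    rewrite plus_INR, Rmult_plus_distr_l, IH1, IH2.
    simpl. rewrite <- (Rmult_assoc golden golden),
      <- (Rmult_assoc golden_conj golden_conj), golden_sqr, golden_conj_sqr.
    ring.
Qed.

Lemma binet_lucas (n : nat) :
  INR (lucas n) = golden ^ n + golden_conj ^ n.
Proof.
  enough (INR (lucas n) = golden ^ n + golden_conj ^ n /\
    INR (lucas (S n)) = golden ^ S n + golden_conj ^ S n) by tauto.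
  induction n as [|n [IH1 IH2]].
  - unfold golden, golden_conj. simpl. lra.
  - split; [exact IH2|].
    change (lucas (S (S n))) with (lucas (S n) + lucas n)%nat.
    rewrite plus_INR, IH1, IH2.
    simpl. rewrite <- (Rmult_assoc golden golden),
      <- (Rmult_assoc golden_conj golden_conj), golden_sqr, golden_conj_sqr.
    ring.
Qed.

Lemma lucas_pos (n : nat) : (0 < lucas n)%nat.
Proof.
  enough (0 < lucas n /\ 0 < lucas (S n))%nat by tauto.
  induction n as [|n [IH1 IH2]]; [simpl; lia|].
  split; [exact IH2|].
  change (lucas (S (S n))) with (lucas (S n) + lucas n)%nat. lia.
Qed.

Lemma fib_pos (n : nat) : (0 < n)%nat -> (0 < fib n)%nat.
Proof.
  destruct n as [|n]; [lia|]. intros _.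
  enough (0 < fib (S n) /\ 0 < fib (S (S n)))%nat by tauto.
  induction n as [|n [IH1 IH2]]; [simpl; lia|].
  split; [exact IH2|].
  change (fib (S (S (S n)))) with (fib (S (S n)) + fib (S n))%nat. lia.
Qed.

(** * Binomial sums with Fibonacci, Lucas and Bernoulli numbers *)

(** Since L_j = a + b, the number 1 - 2a/L_j is (b - a)/L_j, and exchanging a and b changes its
    sign. *)
Lemma opposite_bases (j : nat) (q : R) :
  q = sqrt 5 * INR (fib j) / INR (lucas j) ->
  - q = -2 * golden ^ j / INR (lucas j) + 1 /\
  q = -2 * golden_conj ^ j / INR (lucas j) + 1.
Proof.
  intros Hq.
  assert (HL : 0 < INR (lucas j)) by apply lt_0_INR, lucas_pos.
  rewrite Hq, binet_fib. rewrite binet_lucas in *. split; field; lra.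
Qed.

(** Both powers on the right expand by [binomial_1], and Binet merges a^k + b^k into L_(jk). *)
Lemma lucas_binomial_sum (m j : nat) (q : R) :
  q = sqrt 5 * INR (fib j) / INR (lucas j) ->
  sum_f_R0 (fun k => Binomial.C m k * ((-2) ^ k *
    (INR (lucas (j * k)) / INR (lucas j) ^ k))) m = (- q) ^ m + q ^ m.
Proof.
  intros Hq.
  destruct (opposite_bases j q Hq) as [Ha Hb].
  rewrite Ha, Hb, <- !binomial_1, <- plus_sum.
  apply sum_eq. intros k _.
  rewrite (binet_lucas (j * k)), !pow_mult. unfold Rdiv.
  rewrite !Rpow_mult_distr, pow_inv. ring.
Qed.

Lemma fib_binomial_sum (m j : nat) (q : R) :
  q = sqrt 5 * INR (fib j) / INR (lucas j) ->
  sum_f_R0 (fun k => Binomial.C m k * ((-2) ^ k *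
    (sqrt 5 * INR (fib (j * k)) / INR (lucas j) ^ k))) m = (- q) ^ m - q ^ m.
Proof.
  intros Hq.
  destruct (opposite_bases j q Hq) as [Ha Hb].
  rewrite Ha, Hb, <- !binomial_1, <- minus_sum.
  apply sum_eq. intros k _.
  rewrite (binet_fib (j * k)), !pow_mult. unfold Rdiv.
  rewrite !Rpow_mult_distr, pow_inv. ring.
Qed.

(* [C n k / (n - k + 1)] is [C (n + 1) k / (n + 1)]; the missing term
   [k = n + 1] vanishes because [B (n + 1) = 0]. *)
Lemma bernoulli_sum_lucas (B : nat -> R) (n : nat) :
  is_bernoulli B -> (1 <= n)%nat ->
  (1 + (-1) ^ n) *
  sum_f_R0 (fun k => Binomial.C n k * 2 ^ k * (B k / INR (n - k + 1))) n = 0.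
Proof.
  intros hB hn. destruct (Nat.Even_or_Odd n) as [He|[m ->]].
  2: { rewrite Nat.add_1_r, pow_1_odd. ring. }
  assert (Ho : Nat.Odd (S n)) by (apply Nat.Odd_succ, He).
  pose proof (bernoulli_sum_2 B (S n) hB Ho) as H.
  rewrite tech5, (bernoulli_odd B (S n) hB Ho) in H.
  replace (S n =? 1) with false in H
    by (symmetry; apply Nat.eqb_neq; lia).
  rewrite !Rmult_0_r, Rplus_0_r in H.
  rewrite (sum_eq _ (fun k => Binomial.C (S n) k * (2 ^ k * B k)
                              * / INR (S n))).
  - rewrite <- scal_sum, H. ring.
  - intros k Hk. unfold Binomial.C.
    replace (S n - k)%nat with (S (n - k)) by lia. rewrite Nat.add_1_r.
    rewrite !fact_simpl, !mult_INR. field.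
    repeat split; try apply INR_fact_neq_0; apply not_0_INR; lia.
Qed.

(** For odd n both sides vanish. For even n, absorbing twice turns C(n,k)/((k+1)(k+2)) into
    C(n+2,k+2)/((n+1)(n+2)), and 2^k (2^(k+3) - 2) is half of 4^(k+2) - 2^(k+2). This gives the sum
    of [bernoulli_sum_4] for N = n + 2 without its first two terms, and those account for the
    right-hand side. *)
Lemma bernoulli_sum_fib (B : nat -> R) (n : nat) :
  is_bernoulli B -> (1 <= n)%nat ->
  (1 + (-1) ^ n) *
  sum_f_R0 (fun k => Binomial.C n k * (2 ^ k / (INR k + 1)) *
    ((2 ^ (k + 3) - 2) / (INR k + 2) * B (k + 2)%nat)) n
  = (1 + (-1) ^ n) / (2 * (INR n + 1)).
Proof.
  intros hB hn. destruct (Nat.Even_or_Odd n) as [He|[m ->]].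
  2: { rewrite Nat.add_1_r, pow_1_odd. unfold Rdiv. ring. }
  assert (He2 : Nat.Even (S (S n))) by (apply Nat.Even_succ_succ, He).
  pose proof (bernoulli_sum_4 B (S (S n)) hB He2) as H.
  rewrite decomp_sum in H by lia. simpl pred in H.
  rewrite decomp_sum in H by lia. simpl pred in H.
  rewrite C_n_1, (bernoulli_odd B 1 hB) in H by (exists 0%nat; reflexivity).
  simpl (1 =? 1) in H. rewrite S_INR in H.
  pose proof (pos_INR n) as Hn.
  rewrite (sum_eq _ (fun k => Binomial.C (S (S n)) (S (S k)) *
      ((4 ^ S (S k) - 2 ^ S (S k)) * B (S (S k))) *
      (/ 2 / ((INR n + 1) * (INR n + 2))))).
  - rewrite <- scal_sum.
    (* The term of index 0 is zero and that of index 1 is (n+2)(4-2)(-1/2) = -(n+2), so the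
       remaining sum is n + 2. *)
    match type of H with _ + (_ + ?S) = 0 =>
      replace S with (INR n + 2) by (simpl in H |- *; lra) end.
    field. lra.
  - intros k Hk. pose proof (pos_INR k).
    replace (k + 2)%nat with (S (S k)) by lia.
    replace (Binomial.C n k * (2 ^ k / (INR k + 1)) *
      ((2 ^ (k + 3) - 2) / (INR k + 2) * B (S (S k))))
      with (Binomial.C n k / (INR k + 1) / (INR (S k) + 1) *
            (2 ^ k * (2 ^ (k + 3) - 2) * B (S (S k))))
      by (rewrite S_INR; field; lra).
    rewrite absorption by exact Hk.
    replace (Binomial.C (S n) (S k) / (INR n + 1) / (INR (S k) + 1))
      with (Binomial.C (S n) (S k) / (INR (S k) + 1) / (INR n + 1))
      by (rewrite S_INR; field; lra).
    rewrite absorption by lia. rewrite S_INR.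
    replace (4 ^ S (S k)) with (2 ^ S (S k) * 2 ^ S (S k))
      by (rewrite <- Rpow_mult_distr; f_equal; ring).
    rewrite pow_add. simpl pow. field. lra.
Qed.

(** By absorption this is [fib_binomial_sum] for n + 1 with the index shifted by one. The prefactor
    collects the surplus -2, 1/L_j and sqrt 5 of each term; its sign reverses the difference of
    powers. *)
Lemma fib_shifted_sum (n j : nat) (q : R) :
  q = sqrt 5 * INR (fib j) / INR (lucas j) ->
  sum_f_R0 (fun k => Binomial.C n k * (2 ^ k / (INR k + 1)) *
    ((-1) ^ k * (INR (fib (j * (k + 1))) / INR (lucas j) ^ k))) n
  = INR (lucas j) / (2 * sqrt 5 * (INR n + 1)) * (q ^ S n - (- q) ^ S n).
Proof.
  intros Hq.
  assert (HL : 0 < INR (lucas j)) by apply lt_0_INR, lucas_pos.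
  pose proof sqrt5_pos. pose proof (pos_INR n).
  pose proof (fib_binomial_sum (S n) j q Hq) as Hs.
  rewrite decomp_sum in Hs by lia. simpl pred in Hs.
  rewrite Nat.mul_0_r in Hs. simpl (INR (fib 0)) in Hs.
  replace (q ^ S n - (- q) ^ S n) with (- ((- q) ^ S n - q ^ S n)) by ring.
  rewrite <- Hs.
  (* The term [z] split off at index 0 contains F_0 = 0. *)
  match goal with |- _ = _ * - (?z + ?S) =>
    replace z with 0 by (unfold Rdiv; ring);
    replace (INR (lucas j) / (2 * sqrt 5 * (INR n + 1)) * - (0 + S))
      with (- INR (lucas j) / (2 * sqrt 5 * (INR n + 1)) * S)
      by (unfold Rdiv; ring) end.
  rewrite scal_sum. apply sum_eq. intros k Hk. pose proof (pos_INR k).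
  rewrite Nat.add_1_r.
  replace (Binomial.C (S n) (S k))
    with (Binomial.C n k / (INR k + 1) * (INR n + 1)).
  2: { rewrite absorption by exact Hk. field. lra. }
  replace (-2) with (-1 * 2) by ring. rewrite Rpow_mult_distr.
  assert (INR (lucas j) ^ k <> 0) by (apply pow_nonzero; lra).
  simpl pow. field. repeat split; lra.
Qed.

(** * Assembly of the four identities *)

Lemma sum_n_m_0_Reals (f : nat -> R) (n : nat) :
  sum_n_m f 0 n = sum_f_R0 f n.
Proof. exact (sum_n_Reals f n). Qed.

Lemma sum_n_m_1_Reals (f : nat -> R) (n : nat) :
  (1 <= n)%nat ->
  sum_n_m f 1 n = sum_f_R0 (fun k => f (S k)) (pred n).
Proof.
  intros Hn. destruct n as [|n]; [lia|].
  rewrite <- sum_n_m_0_Reals. symmetry. apply sum_n_m_S.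
Qed.

Theorem theorem4 (B : nat -> R) (hB : is_bernoulli B)
    (n j : nat) (hn : (1 <= n)%nat) (hj : (1 <= j)%nat) :
  sum_n_m (fun k : nat =>
      Binomial.C n k * (2 ^ k / (INR k + 1)) *
      ((-1) ^ k * (INR (fib (j * (k + 1))) / INR (lucas j) ^ k)
         * (INR (lucas j) / (sqrt 5 * INR (fib j))) ^ n
       - (1 + (-1) ^ n) * ((2 ^ (k + 3) - 2) / (INR k + 2))
         * INR (fib j) * B (k + 2)%nat)) 0 n = 0
  /\
  sum_n_m (fun k : nat =>
      (-1) ^ k * Binomial.C (2 * n - 1) (k - 1) *
      (2 ^ k * INR (fib (j * k)) / (INR k * INR (lucas j) ^ k))) 1 (2 * n) = 0
  /\
  sum_n_m (fun k : nat =>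
      Binomial.C n k * 2 ^ k *
      ((-1) ^ k * (INR (lucas (j * k)) / INR (lucas j) ^ k)
         * (INR (lucas j) / (sqrt 5 * INR (fib j))) ^ n
       - (1 + (-1) ^ n) / INR (n - k + 1) * B k)) 0 n = 1 + (-1) ^ n
  /\
  sum_n_m (fun k : nat =>
      (-1) ^ k * Binomial.C (2 * n - 1) k *
      (2 ^ k * INR (lucas (j * k)) / INR (lucas j) ^ k)) 0 (2 * n - 1) = 0.
Proof.
  assert (HL : 0 < INR (lucas j)) by apply lt_0_INR, lucas_pos.
  assert (HF : 0 < INR (fib j)) by (apply lt_0_INR, fib_pos; lia).
  pose proof sqrt5_pos as H5. pose proof (pos_INR n) as Hn0.
  set (q := sqrt 5 * INR (fib j) / INR (lucas j)).
  assert (Hq : q <> 0).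
  { apply Rgt_not_eq, Rdiv_lt_0_compat; [|exact HL].
    apply Rmult_lt_0_compat; assumption. }
  replace (INR (lucas j) / (sqrt 5 * INR (fib j))) with (/ q)
    by (unfold q; field; lra).
  assert (Hqn : forall m, q ^ m * (/ q) ^ m = 1).
  { intros m. rewrite <- Rpow_mult_distr, Rinv_r, pow1 by exact Hq.
    reflexivity. }
  assert (Hneg : forall m, (- q) ^ m = (-1) ^ m * q ^ m).
  { intros m. rewrite <- Rpow_mult_distr. f_equal. ring. }
  (* The exponent 2n - 1 is odd; this is why the second and fourth sums vanish. *)
  assert (Hodd : (- q) ^ (2 * n - 1) = - q ^ (2 * n - 1)).
  { rewrite Hneg. replace (2 * n - 1)%nat with (S (2 * (n - 1))) by lia.
    rewrite pow_1_odd. ring. }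
  split; [|split; [|split]].
  - pose proof (bernoulli_sum_fib B n hB hn) as HB.
    pose proof (fib_shifted_sum n j q eq_refl) as HS.
    rewrite sum_n_m_0_Reals.
    match goal with |- ?x = ?y => change (x = y :> R) end.
    (* The summand splits into a Fibonacci part [g], scaled by q^(-n), and a Bernoulli part [f]. *)
    match type of HB with _ * sum_f_R0 ?f _ = _ =>
    match type of HS with sum_f_R0 ?g _ = _ =>
      rewrite (sum_eq _ (fun k => g k * (/ q) ^ n
                 - f k * ((1 + (-1) ^ n) * INR (fib j)))) end end.
    2: { intros k _. unfold Rdiv. ring. }
    rewrite minus_sum, <- !scal_sum, HS.
    match type of HB with _ * ?S = _ =>
      replace ((1 + (-1) ^ n) * INR (fib j) * S)
        with (INR (fib j) * ((1 + (-1) ^ n) * S)) by ring end.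
    rewrite HB, Hneg. simpl pow.
    replace ((/ q) ^ n * (INR (lucas j) / (2 * sqrt 5 * (INR n + 1)) *
        (q * q ^ n - -1 * (-1) ^ n * (q * q ^ n))))
      with (q ^ n * (/ q) ^ n * (INR (lucas j) * q *
        (1 + (-1) ^ n) / (2 * sqrt 5 * (INR n + 1))))
      by (unfold Rdiv; ring).
    (* As L_j q = sqrt 5 F_j, both halves equal F_j (1 + (-1)^n) / (2(n+1)) and cancel. *)
    rewrite Hqn. unfold q. field. repeat split; lra.
  - pose proof (fib_shifted_sum (2 * n - 1) j q eq_refl) as HS.
    rewrite (sum_n_m_1_Reals _ (2 * n)) by lia.
    replace (pred (2 * n)) with (2 * n - 1)%nat by lia.
    match goal with |- ?x = ?y => change (x = y :> R) end.
    (* After the shift of k by one, each term has an extra factor -2/L_j. *)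
    match type of HS with sum_f_R0 ?g _ = _ =>
      rewrite (sum_eq _ (fun k => g k * (- 2 / INR (lucas j)))) end.
    2: { intros k _. replace (S k - 1)%nat with k by lia.
      rewrite Nat.add_1_r, S_INR. simpl pow. pose proof (pos_INR k).
      field. repeat split; try apply pow_nonzero; lra. }
    (* The powers of q and -q now have the even exponent 2n, so their difference is 0. *)
    rewrite <- scal_sum, HS, <- !tech_pow_Rmult, Hodd.
    unfold Rdiv. ring.
  - pose proof (bernoulli_sum_lucas B n hB hn) as HB.
    pose proof (lucas_binomial_sum n j q eq_refl) as HS.
    rewrite sum_n_m_0_Reals.
    match goal with |- ?x = ?y => change (x = y :> R) end.
    match type of HB with _ * sum_f_R0 ?f _ = _ =>
    match type of HS with sum_f_R0 ?g _ = _ =>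
      rewrite (sum_eq _ (fun k => g k * (/ q) ^ n
                 - f k * (1 + (-1) ^ n))) end end.
    2: { intros k _. replace (-2) with (-1 * 2) by ring.
      rewrite Rpow_mult_distr. unfold Rdiv. ring. }
    rewrite minus_sum, <- !scal_sum, HS, HB, Hneg.
    (* The Bernoulli half is 0, and q^(-n) ((-q)^n + q^n) alone yields 1 + (-1)^n. *)
    replace ((/ q) ^ n * ((-1) ^ n * q ^ n + q ^ n) - 0)
      with (q ^ n * (/ q) ^ n * (1 + (-1) ^ n)) by ring.
    rewrite Hqn. ring.
  - rewrite sum_n_m_0_Reals.
    match goal with |- ?x = ?y => change (x = y :> R) end.
    rewrite (sum_eq _ (fun k => Binomial.C (2 * n - 1) k * ((-2) ^ k *
      (INR (lucas (j * k)) / INR (lucas j) ^ k)))).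
    + rewrite (lucas_binomial_sum _ j q eq_refl), Hodd. ring.
    + intros k _. replace (-2) with (-1 * 2) by ring.
      rewrite Rpow_mult_distr. unfold Rdiv. ring.
Qed.
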